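(* Let $d,N\in\mathbb{N}$ and suppose that $V:(\mathbb{R}^d)^N\to\mathbb{R}$ is continuously differentiable and semiconvex. Let $m_i>0$ and $(x_i,v_i)\in\mathbb{R}^d\times\mathbb{R}^d$ be given for $i=1,\dots,N$. Then the system $$ \begin{cases} m_i\ddot\gamma_i(t)=-D_{x_i}V(\gamma_1(t),\dots,\gamma_N(t)),\quad t>0,\\ \gamma_i(0)=x_i,\\ \dot\gamma_i(0)=v_i \end{cases} \qquad (i=1,\dots,N) $$ has a solution $\gamma_1,\dots,\gamma_N\in C^2([0,\infty);\mathbb{R}^d)$.
   Context: Points of $(\mathbb{R}^d)^N$ are written $x=(x_1,\dots,x_N)$ with $x_i\in\mathbb{R}^d$, and $|x|=\left(\sum_{i=1}^N|x_i|^2\right)^{1/2}$. $D_{x_i}V$ denotes the gradient of $V$ with respect to the $i$-th variable $x_i\in\mathbb{R}^d$. A function $V:(\mathbb{R}^d)^N\to\mathbb{R}$ is called semiconvex if there is $C\ge 0$ such that $x\mapsto V(x)+\frac{C}{2}|x|^2$ is convex on $(\mathbb{R}^d)^N$. *)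

(* Defs.v *)
From mathcomp Require Import all_boot all_order all_algebra.
From mathcomp Require Import interval_inference.
From mathcomp Require Import boolp classical_sets functions set_interval reals.
From mathcomp Require Import topology normedtype derive convex.

Set Implicit Arguments.
Unset Strict Implicit.
Unset Printing Implicit Defensive.

Import Order.TTheory GRing.Theory Num.Theory.
Import numFieldNormedType.Exports.

Local Open Scope classical_set_scope.
Local Open Scope ring_scope.

(* A point x = (x_1, ..., x_N) of (R^d)^N is a matrix x : 'M[R]_(N, d) whose
   i-th row is x_i. *)

(* The library norm of matrices is the sup norm, so the Euclidean norm has to be
   introduced separately. *)
Definition euclid_norm (R : realType) (m n : nat) (x : 'M[R]_(m, n)) : R :=
  Num.sqrt (\sum_(i < m) \sum_(j < n) x i j ^+ 2).

Definition grad_var (R : realType) (N d : nat) (V : 'M[R]_(N, d) -> R^o)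
    (i : 'I_N) (x : 'M[R]_(N, d)) : 'rV[R]_d :=
  \row_(j < d) 'D_(delta_mx i j) V x.

Definition continuously_differentiable (R : realType) (N d : nat)
    (V : 'M[R]_(N, d) -> R^o) : Prop :=
  (forall x, differentiable V x) /\ (forall i, continuous (grad_var V i)).

Definition semiconvex (R : realType) (N d : nat)
    (V : 'M[R]_(N, d) -> R^o) : Prop :=
  exists2 C : R, 0 <= C &
    convex_function [set: convex_lmodType 'M[R]_(N, d)]
      (fun x => V x + C / 2 * euclid_norm x ^+ 2).

(* Derivatives relative to a set A of times: at interior points of A this is the
   usual derivative f^`(), and at the endpoint 0 of `[0, +oo[ it is the
   one-sided derivative.  The values outside A are irrelevant. *)
Definition derivable_within (R : realType) (W : normedModType R) (A : set R)
    (f : R -> W) (t : R) : Prop :=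
  cvg ((s - t)^-1 *: (f s - f t) @[s --> within A t^']).

Definition derive_within (R : realType) (W : normedModType R) (A : set R)
    (f : R -> W) (t : R) : W :=
  lim ((s - t)^-1 *: (f s - f t) @[s --> within A t^']).

Definition C1_within (R : realType) (W : normedModType R) (A : set R)
    (f : R -> W) : Prop :=
  (forall t, A t -> derivable_within A f t) /\
  {within A, continuous (derive_within A f)}.

Definition C2_within (R : realType) (W : normedModType R) (A : set R)
    (f : R -> W) : Prop :=
  C1_within A f /\ C1_within A (derive_within A f).

(* Main.v *)
Require Import Defs.
From mathcomp Require Import all_boot all_order all_algebra.
From mathcomp Require Import interval_inference.
From mathcomp Require Import boolp classical_sets functions set_interval reals.
From mathcomp Require Import topology normedtype derive convex.
From mathcomp Require Import prodnormedzmodule sequences realfun exp ring lra.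

(* Semiconvexity bounds V from below by a quadratic, so conservation of energy
   gives |v|^2 <= c (1 + |x|^2) along any solution, and Gronwall's inequality
   gives an explicit bound of the form D e^(K t) on positions and velocities.
   Clamping the arguments of the vector field at a slightly larger,
   time-dependent radius M(t) makes the field locally bounded in time without
   affecting solutions: they never reach the radius.  The clamped equation is
   solved globally by Peano's theorem.  In the latter, the Euler step functions
   are made to converge pointwise along an ultrafilter on the step numbers, and
   the limit is differentiated directly from an estimate that survives
   pointwise limits, so that neither integrals nor uniform convergence are
   needed. *)

Set Implicit Arguments.
Unset Strict Implicit.
Unset Printing Implicit Defensive.

Import Order.TTheory GRing.Theory Num.Theory.
Import numFieldNormedType.Exports.

Local Open Scope classical_set_scope.
Local Open Scope ring_scope.

(** * Peano's theorem for locally bounded fields *)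

(** At a fixed [s] the estimate is non-strict and free of quotients, so it passes to pointwise
    limits of functions; dividing by [s - t] recovers the difference quotient. *)
Lemma is_derive1_of_estimate (R : realType) (W : normedModType R)
    (f : R -> W) (t : R) (a : W) :
  (forall e, 0 < e ->
     \forall s \near t, `|f s - f t - (s - t) *: a| <= e * `|s - t|) ->
  is_derive t 1 f a.
Proof.
move=> fta.
have cv : h^-1 *: ((f \o shift t) (h *: 1) - f t) @[h --> 0^'] --> a.
  apply/cvgrPdist_le => e e0.
  have /nbhs_ballP[d /= d0 dP] := fta e e0.
  exists d => //= h hd h0.
  have := dP (h + t); rewrite -ball_normE/= opprD addrCA subrr addr0 addrK.
  rewrite normrN => hP.
  rewrite /ball/= sub0r normrN in hd.
  move/(_ hd) : hP => hP.
  rewrite /= [h *: 1]mulr1 distrC.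
  have -> : h^-1 *: (f (h + t) - f t) - a
          = h^-1 *: (f (h + t) - f t - h *: a).
    by rewrite [in RHS]scalerBr scalerA mulVf// scale1r.
  by rewrite normrZ normfV mulrC ler_pdivrMr ?normr_gt0.
by apply: DeriveDef; [apply/cvg_ex; exists a|exact: cvg_lim].
Qed.

Section euler_scheme.
Context (R : realType) (E : normedModType R) (G : R -> E -> E) (h : R) (z0 : E).

Fixpoint euler (n : nat) : E :=
  if n is n'.+1 then euler n' + h *: G (n'%:R * h) (euler n') else z0.

(** Telescoping: each Euler step adds [h *: (G _ _ - a)], of norm at most [h * e]. Both orders of
    [n] and [p] are allowed because [s] will lie on either side of [t]. The case [a = 0] is a
    Lipschitz bound. *)
Lemma euler_drift (a : E) (e : R) (n p : nat) : 0 <= h ->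
  (forall j, (minn n p <= j < maxn n p)%N ->
     `|G (j%:R * h) (euler j) - a| <= e) ->
  `|euler p - euler n - ((p%:R - n%:R) * h) *: a| <= e * (`|p%:R - n%:R| * h).
Proof.
move=> h0; wlog np : n p / (n <= p)%N => [hw|].
  have /orP[np|pn] := leq_total n p; first exact: hw.
  move=> jP; have := hw p n pn; rewrite minnC maxnC => /(_ jP).
  have -> : euler n - euler p - ((n%:R - p%:R) * h) *: a
      = - (euler p - euler n - ((p%:R - n%:R) * h) *: a).
    rewrite -[in LHS]scaleNr -[in LHS]mulNr [in LHS]opprB.
    by rewrite !opprD !opprK (addrC (euler n)).
  by rewrite normrN [`|n%:R - _|]distrC.
rewrite (minn_idPl np) (maxn_idPr np) -(subnKC np).
elim: (p - n)%N => {np p} [|p IH] jP.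
  by rewrite addn0 !subrr mul0r scale0r subr0 !normr0 mul0r mulr0.
have -> : euler (n + p.+1) - euler n - (((n + p.+1)%:R - n%:R) * h) *: a
  = (euler (n + p) - euler n - (((n + p)%:R - n%:R) * h) *: a)
    + h *: (G ((n + p)%:R * h) (euler (n + p)) - a).
  have -> : (n + p.+1)%:R - n%:R = ((n + p)%:R - n%:R) + 1 :> R.
    by rewrite addnS -natr1; ring.
  rewrite addnS /= scalerBr mulrDl mul1r scalerDl opprD -!addrA.
  by congr (_ + _); rewrite addrCA; congr (_ + _); rewrite addrCA.
apply: le_trans (ler_normD _ _) _.
rewrite normrZ (ger0_norm h0).
have -> : e * (`|(n + p.+1)%:R - n%:R| * h)
   = e * (`|(n + p)%:R - n%:R| * h) + h * e.
  by rewrite !natrD !(addrC n%:R) !addrK !ger0_norm// -natr1; ring.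
rewrite lerD//.
  apply: IH => j /andP[nj jp]; apply: jP.
  by rewrite nj/= (leq_trans jp)// addnS.
by apply: ler_wpM2l => //; apply: jP; rewrite leq_addr addnS/=.
Qed.

End euler_scheme.

(** A cluster point of an ultrafilter is a limit: for each neighbourhood, its preimage or the
    complement of that preimage belongs to [U], and clustering excludes the latter. This replaces
    the extraction of a subsequence. *)
Lemma ultra_cvg_compact (I : Type) (T : topologicalType) (U : set_system I)
    (f : I -> T) (K : set T) :
  UltraFilter U -> compact K -> U (f @^-1` K) -> exists p : T, f @ U --> p.
Proof.
move=> UU cK UK; have [p [_ clp]] := cK (f @ U) _ UK; exists p => A pA.
have [//|UnA] := in_ultra_setVsetC (f @^-1` A) UU.
by have [x [/= + Ax]] := clp (~` A) A UnA pA.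
Qed.

Lemma truncn_grid (R : realType) (t : R) (k : nat)
    (j := Num.truncn (t * k.+1%:R)) :
  0 <= t -> j%:R * k.+1%:R^-1 <= t /\ `|j%:R * k.+1%:R^-1 - t| <= k.+1%:R^-1.
Proof.
move=> t0; have k0 : 0 < k.+1%:R :> R by [].
have /andP[jt tj] : j%:R <= t * k.+1%:R < j.+1%:R.
  by apply: truncn_itv; rewrite mulr_ge0.
have jt' : j%:R * k.+1%:R^-1 <= t by rewrite ler_pdivrMr.
split=> //; rewrite distrC ger0_norm ?subr_ge0// lerBlDl.
by rewrite -[X in _ + X]mul1r -mulrDl natr1 ler_pdivlMr// ltW.
Qed.

Section peano.
Context (R : realType) (E : normedModType R) (G : R -> E -> E) (z0 : E).
Hypothesis cG : continuous (fun p : R * E => G p.1 p.2).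

Let step (k : nat) : R := k.+1%:R^-1.
(** Step functions suffice instead of polygons: rounding times to the grid costs a multiple of
    [step k], which vanishes in the limit. *)
Let Y (k : nat) (t : R) : E := euler G (step k) z0 (Num.truncn (t * k.+1%:R)).

Let step_ge0 k : 0 <= step k. Proof. by rewrite /step invr_ge0. Qed.

Let index_lt (t T : R) k j : 0 <= t -> t <= T ->
  (j < Num.truncn (t * k.+1%:R))%N -> 0 <= j%:R * step k <= T.
Proof.
move=> t0 tT jt; rewrite mulr_ge0//=.
have [+ _] := truncn_grid k t0; move=> /le_trans/(_ tT); apply: le_trans.
by rewrite ler_wpM2r// ler_nat ltnW.
Qed.

Let euler_lip k (t s T B : R) : 0 <= t <= T -> 0 <= s <= T ->
  (forall (r : R) z, 0 <= r <= T -> `|G r z| <= B) -> forall n p : nat,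
  (maxn n p <= maxn (Num.truncn (t * k.+1%:R)) (Num.truncn (s * k.+1%:R)))%N ->
  `|euler G (step k) z0 p - euler G (step k) z0 n|
    <= B * (`|p%:R - n%:R| * step k).
Proof.
move=> /andP[t0 tT] /andP[s0 sT] GB n p np.
have := @euler_drift _ _ G (step k) z0 0 B n p (step_ge0 k).
rewrite scaler0 subr0; apply => j /andP[_ jnp]; rewrite subr0; apply: GB.
have := leq_trans jnp np; rewrite leq_max => /orP[|]; exact: index_lt.
Qed.

Let Y_bounded k (t T B : R) : 0 <= t <= T ->
  (forall (r : R) z, 0 <= r <= T -> `|G r z| <= B) -> `|Y k t| <= `|z0| + B * T.
Proof.
move=> tT GB; have /andP[t0 tT'] := tT.
have := euler_lip (k := k) tT tT GB (n := 0%N) (p := Num.truncn (t * k.+1%:R)).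
rewrite max0n maxnn => /(_ (leqnn _)) /=; rewrite subr0 ger0_norm// => YB.
rewrite -(subrK z0 (Y k t)) addrC (le_trans (ler_normD _ _))// lerD2l.
apply: le_trans YB _; apply: ler_wpM2l.
  by apply: le_trans (GB 0 0 _); rewrite ?normr_ge0// lexx (le_trans t0).
by have [+ _] := truncn_grid k t0; move=> /le_trans; apply.
Qed.

Let step_lt (e : R) : 0 < e -> \forall k \near \oo, step k < e.
Proof. by move=> e0; exact: (near_infty_natSinv_lt (PosNum e0)). Qed.

(** The nodes visited between [t] and [s] stay so close to [(t, y)] that [G] differs there from
    [G t y] by at most [e], and [euler_drift] applies. The last term pays for rounding [t] and [s]
    to the grid. The threshold [d] does not depend on [k]. *)
Let Y_drift (t e T B : R) (y : E) : 0 <= t -> t < T -> 0 < e ->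
  (forall (r : R) z, 0 <= r <= T -> `|G r z| <= B) ->
  exists2 d : R, 0 < d & forall s : R, 0 <= s -> `|s - t| < d ->
    forall k, step k < d -> `|Y k t - y| < d ->
    `|Y k s - Y k t - (s - t) *: G t y|
      <= e * `|s - t| + (e + `|G t y|) * step k *+ 2.
Proof.
move=> t0 tT e0 GB.
have B0 : 0 <= B.
  by apply: le_trans (GB 0 0 _); rewrite ?normr_ge0// lexx (le_trans t0)// ltW.
have /nbhs_ballP[d0 /= d00 d0G] :
    nbhs (t, y) (fun p : R * E => `|G p.1 p.2 - G t y| <= e).
  have /cvgrPdist_le/(_ e e0) := @cG (t, y).
  by apply: filterS => p /=; rewrite distrC.
(* The nodes are within [4 * d] of [t] and, moving with speed at most [B] for a time below [3 * d],
   within [d + 3 * B * d] of [y]; [d * (4 + 3 * B)] dominates both. The bound [T - t] keeps [s] in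
   the range where [B] is valid. *)
pose d := Num.min (T - t) (d0 / (4 + 3 * B)).
have d_gt0 : 0 < d by rewrite lt_min subr_gt0 tT divr_gt0//; lra.
have dd0 : d * (4 + 3 * B) <= d0.
  by rewrite -ler_pdivlMr ?ge_min ?lexx ?orbT//; lra.
exists d => // s s0 std k kd Ytd.
have sT : s <= T.
  have : `|s - t| < T - t by apply: lt_le_trans std _; rewrite ge_min lexx.
  by rewrite ltr_norml => /andP[_]; lra.
set n := Num.truncn (t * k.+1%:R); set p := Num.truncn (s * k.+1%:R).
have [_ nt] := truncn_grid k t0; have [_ ps] := truncn_grid k s0.
rewrite -/n -/(step k) in nt; rewrite -/p -/(step k) in ps.
have h0 := step_ge0 k; set h := step k in h0 kd nt ps *.
have pn_h : `|p%:R - n%:R| * h <= `|s - t| + h *+ 2.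
  rewrite -[X in _ * X](ger0_norm h0) -normrM mulrBl.
  have -> : p%:R * h - n%:R * h = (s - t) + ((p%:R * h - s) - (n%:R * h - t)).
    by ring.
  rewrite (le_trans (ler_normD _ _))// lerD2l (le_trans (ler_normB _ _))//.
  by rewrite mulr2n lerD.
have jG j : (minn n p <= j < maxn n p)%N ->
    `|G (j%:R * h) (euler G h z0 j) - G t y| <= e.
  move=> /andP[nj jp].
  have jn : `|j%:R - n%:R| <= `|p%:R - n%:R| :> R.
    have [np|pn] := leqP n p.
      rewrite (minn_idPl np) in nj; rewrite (maxn_idPr np) in jp.
      by rewrite !ger0_norm ?subr_ge0 ?ler_nat// lerD2r ler_nat ltnW.
    rewrite (minn_idPr (ltnW pn)) in nj; rewrite (maxn_idPl (ltnW pn)) in jp.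
    rewrite distrC [leRHS]distrC.
    by rewrite !ger0_norm ?subr_ge0 ?ler_nat 1?ltnW// lerD2l lerN2 ler_nat.
  have jnh : `|j%:R - n%:R| * h <= `|s - t| + h *+ 2.
    by apply: le_trans pn_h; rewrite ler_wpM2r.
  apply: (d0G (j%:R * h, euler G h z0 j)); split => /=.
    rewrite /ball/= distrC.
    have -> : j%:R * h - t = (j%:R - n%:R) * h + (n%:R * h - t) by ring.
    rewrite (le_lt_trans (ler_normD _ _))// normrM (ger0_norm h0).
    have : 0 <= B * d by rewrite mulr_ge0// ltW.
    by move: jnh nt std kd dd0; rewrite mulr2n; lra.
  rewrite -ball_normE/= distrC -(subrKA (euler G h z0 n)).
  rewrite (le_lt_trans (ler_normD _ _))//.
  have tT' : 0 <= t <= T by rewrite t0 ltW.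
  have sT' : 0 <= s <= T by rewrite s0.
  have jnp : (maxn n j <= maxn n p)%N by rewrite geq_max leq_maxl ltnW.
  have := euler_lip (k := k) tT' sT' GB jnp; rewrite -/h => ejn.
  have : B * (`|j%:R - n%:R| * h) <= B * (d *+ 3).
    rewrite ler_wpM2l// (le_trans jnh)//.
    by move: std kd; rewrite !mulrS !mulr0n; lra.
  rewrite -/(Y k t) in Ytd *; move: ejn Ytd dd0 d_gt0.
  rewrite /Y -/n -/h !mulrS !mulr0n; lra.
have {jG} := euler_drift h0 jG => drift.
(* Passing from grid times back to [s - t] moves the linear term by at most two steps times the norm
   of [G t y]. *)
have -> : Y k s - Y k t - (s - t) *: G t y
    = (euler G h z0 p - euler G h z0 n - ((p%:R - n%:R) * h) *: G t y)
      + ((p%:R * h - s) - (n%:R * h - t)) *: G t y.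
  have -> : (p%:R * h - s) - (n%:R * h - t) = (p%:R - n%:R) * h - (s - t).
    by ring.
  by rewrite [in RHS]scalerBl addrA subrK.
rewrite (le_trans (ler_normD _ _))// normrZ.
have H1 : `|p%:R * h - s - (n%:R * h - t)| * `|G t y| <= h *+ 2 * `|G t y|.
  rewrite ler_wpM2r// (le_trans (ler_normB _ _))//.
  by rewrite mulr2n lerD.
have H2 : e * (`|p%:R - n%:R| * h) <= e * (`|s - t| + h *+ 2).
  by rewrite ler_wpM2l// ltW.
apply: le_trans (lerD (le_trans drift H2) H1) _.
rewrite le_eqVlt; apply/orP; left; apply/eqP; ring.
Qed.

Hypothesis cE : forall r : R, compact [set z : E | `|z| <= r].
Hypothesis bG : forall T : R, exists B : R,
  forall (t : R) z, 0 <= t <= T -> `|G t z| <= B.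

(** The local bounds on [G] keep the approximations at each time in a compact ball, which gives the
    limits. As [k] runs along the ultrafilter the rounding term of [Y_drift] vanishes, leaving the
    hypothesis of [is_derive1_of_estimate]. *)
Lemma peano : exists2 y : R -> E,
  y 0 = z0 & forall t : R, 0 <= t -> is_derive t 1 y (G t (y t)).
Proof.
(* A single ultrafilter, fixed before any time, serves all [t] at once, in place of a diagonal
   extraction. *)
have [U [UU ooU]] := ultraFilterLemma eventually_filter.
have Ycvg (t : R) : 0 <= t -> exists y : E, Y k t @[k --> U] --> y.
  move=> t0; have [B GB] := bG t.
  have Yb : U ((Y^~ t) @^-1` [set z | `|z| <= `|z0| + B * t]).
    apply: ooU; exists 0%N => // k _ /=.
    by apply: Y_bounded GB; rewrite t0 lexx.
  exact: (ultra_cvg_compact UU (@cE (`|z0| + B * t)) Yb).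
(* [is_derive] is two-sided even at 0, so [y] has to be prescribed at negative times too. *)
have /choice[y yP] : forall t : R, exists y : E, if 0 <= t then
    Y k t @[k --> U] --> y else y = z0 + t *: G 0 z0.
  move=> t; case: (boolP (0 <= t)) => [/Ycvg//|_].
  by exists (z0 + t *: G 0 z0).
have y0 : y 0 = z0.
  have := yP 0; rewrite lexx => /(cvg_lim (@norm_hausdorff _ _)) <-.
  apply: cvg_lim => //.
  have -> : (fun k => Y k 0) = cst z0.
    by apply/funext => k; rewrite /Y mul0r truncn0.
  exact: cvg_cst.
exists y => // t t0; apply: is_derive1_of_estimate => e e0.
have [B GB] := bG (t + 1).
have tT : t < t + 1 by rewrite ltrDl.
have [d d0 dP] := Y_drift (y t) t0 tT e0 GB.
have yt := yP t; rewrite t0 in yt.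
have sgt0 : \forall s \near t, 0 < t -> 0 < s.
  have [tpos|] := pselect (0 < t); last by move=> tn; exists 1 => //= s _ /tn.
  exists t => //= s; rewrite /ball/= ltr_norml => /andP[_] + _.
  by rewrite ltrBlDr -ltrBlDl subrr.
near=> s.
have [s0|s0] := leP 0 s; last first.
  (* y is affine on negative times, with the slope required at t = 0 *)
  have t00 : t = 0.
    apply/eqP; rewrite eq_le t0 andbT leNgt; apply/negP => tpos.
    have : 0 < t -> 0 < s by near: s.
    by move=> /(_ tpos); rewrite ltNge ltW.
  have := yP s; rewrite leNgt s0/= => ->.
  by rewrite t00 y0 subr0 (addrC z0) addrK subrr normr0 mulr_ge0// ltW.
have ys := yP s; rewrite s0 in ys.
(* Half of the slack [eta] pays for replacing the limits by [Y k], the other half for the rounding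
   term [c * step k *+ 2]; hence [eta / 4] below. *)
apply/ler_addgt0Pr => eta eta0.
pose c := e + `|G t (y t)|.
have c0 : 0 < c by rewrite ltr_wpDr.
have cv : Y k s - Y k t - (s - t) *: G t (y t) @[k --> U] -->
    y s - y t - (s - t) *: G t (y t).
  by apply: cvgB; [exact: cvgB|exact: cvg_cst].
have eta2 : 0 < eta / 2 by rewrite divr_gt0.
have /cvgrPdist_lt/(_ _ eta2) cvd := cv.
have /cvgrPdist_lt/(_ _ d0) Yt := yt.
near U => k.
rewrite -(subrK (Y k s - Y k t - (s - t) *: G t (y t)) (y s - _ - _)).
rewrite (le_trans (ler_normD _ _))//.
have std : `|s - t| < d.
  by rewrite distrC; near: s; exact: (nbhsx_ballx t d d0).
have kd : step k < d by near: k; apply: ooU; exact: step_lt.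
have Ytd : `|Y k t - y t| < d by rewrite distrC; near: k.
have kc : step k < c^-1 * (eta / 4).
  by near: k; apply: ooU; apply: step_lt; rewrite !mulr_gt0 ?invr_gt0.
have XL : `|y s - y t - (s - t) *: G t (y t) -
          (Y k s - Y k t - (s - t) *: G t (y t))| < eta / 2 by near: k.
have := dP s s0 std k kd Ytd; rewrite -/c mulr2n.
by move: kc XL; rewrite ltr_pdivlMl//; lra.
Unshelve. all: by end_near. Qed.

End peano.

(** * Compact balls, clamping and differential inequalities *)

Lemma cvg_mx (R : numFieldType) (T : Type) (F : set_system T) {FF : Filter F}
    m n (f : T -> 'M[R]_(m, n)) (A : 'M[R]_(m, n)) :
  (forall i j, f x i j @[x --> F] --> A i j) -> f @ F --> A.
Proof.
move=> fA P [Q AQ QP].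
have : \forall x \near F, forall i j, Q i j (f x i j).
  apply: filter_forall => i; apply: filter_forall => j; exact: fA (AQ i j).
by apply: filterS => x Qx; apply: QP.
Qed.

Lemma normmx_le (R : realType) m n (A : 'M[R]_(m, n)) (r : R) : 0 <= r ->
  reflect (forall i j, `|A i j| <= r) (`|A| <= r).
Proof.
move=> r0; rewrite [`|A|]/Num.norm/= mx_normrE; apply: (iffP idP).
  by move=> /bigmax_leP[_ +] i j; apply: (fun H => H (i, j) isT).
by move=> Ar; apply: bigmax_le => // -[i j] _; exact: Ar.
Qed.

(** For the sup norm the ball is a box, the image under [vec_mx] of a product of segments. *)
Lemma compact_ball_mx (R : realType) m n (r : R) :
  compact [set A : 'M[R]_(m, n) | `|A| <= r].
Proof.
have [r0|r0] := leP 0 r; last first.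
  rewrite [X in compact X](_ : _ = set0); first exact: compact0.
  apply/seteqP; split => // A /= Ar.
  by have := le_trans (normr_ge0 A) Ar; rewrite leNgt r0.
pose K := [set u : 'rV[R]_(m * n) | forall k, `[- r, r]%classic (u ord0 k)].
have cK : compact K.
  apply: (@rV_compact R _ (fun=> `[- r, r]%classic)) => _.
  exact: segment_compact.
have cvec : continuous (@vec_mx R m n).
  move=> u; apply: (@cvg_mx _ _ (nbhs u)) => i j.
  under eq_fun do rewrite mxE; rewrite mxE; exact: coord_continuous.
rewrite [X in compact X](_ : _ = @vec_mx R m n @` K).
  by apply: continuous_compact => //; exact: continuous_subspaceT.
apply/seteqP; split => [A /= /(normmx_le _ r0) Ar|_ /= [u uK <-]].
  exists (mxvec A); last exact: mxvecK.
  move=> k; case/mxvec_indexP: k => i j.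
  by rewrite mxvecE /= in_itv/= -ler_norml.
apply/(normmx_le _ r0) => i j; rewrite mxE ler_norml.
by have := uK (mxvec_index i j); rewrite /= in_itv.
Qed.

Lemma compact_ball_pair (R : realType) (V W : normedModType R) :
  (forall r : R, compact [set x : V | `|x| <= r]) ->
  (forall r : R, compact [set x : W | `|x| <= r]) ->
  forall r : R, compact [set x : V * W | `|x| <= r].
Proof.
move=> cV cW r.
rewrite [X in compact X](_ : _ =
    [set x : V | `|x| <= r] `*` [set x : W | `|x| <= r]).
  by apply: compact_setX.
by apply/seteqP; split => -[x y]; rewrite /= prod_normE/= ge_max => /andP.
Qed.

(** For [0 <= r], a retraction onto the sup-norm ball of radius [r]; truncating entrywise makes it
    jointly continuous in [r] and [A]. *)
Definition clamp_mx (R : realType) m n (r : R) (A : 'M[R]_(m, n)) :=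
  map_mx (fun x => Num.max (- r) (Num.min r x)) A.

Lemma clamp_mx_id (R : realType) m n (r : R) (A : 'M[R]_(m, n)) :
  `|A| <= r -> clamp_mx r A = A.
Proof.
move=> Ar; have r0 := le_trans (normr_ge0 A) Ar.
apply/matrixP => i j; rewrite mxE.
have := (normmx_le _ r0 Ar) i j; rewrite ler_norml => /andP[? ?].
by rewrite (min_idPr _)// (max_idPr _).
Qed.

Lemma norm_clamp_mx (R : realType) m n (r : R) (A : 'M[R]_(m, n)) : 0 <= r ->
  `|clamp_mx r A| <= r.
Proof.
move=> r0; apply/(normmx_le _ r0) => i j; rewrite mxE ler_norml.
by rewrite le_max lexx/= ge_max ge_min lexx/= andbT; lra.
Qed.

Lemma continuous_clamp_mx (R : realType) m n (T : topologicalType)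
    (r : T -> R) (A : T -> 'M[R]_(m, n)) (x : T) :
  {for x, continuous r} -> {for x, continuous A} ->
  {for x, continuous (fun x => clamp_mx (r x) (A x))}.
Proof.
move=> cr cA; apply: (@cvg_mx _ _ (nbhs x)) => i j.
under eq_fun do rewrite mxE; rewrite mxE.
have cAij : {for x, continuous (fun y => A y i j)}.
  apply: (@continuous_comp _ _ _ A (fun B : 'M[R]_(m, n) => B i j)) => //.
  exact: coord_continuous.
exact: (continuous_max (continuousN cr) (continuous_min cr cAij)).
Qed.

(** A bootstrap: a weak bound up to [T] that improves itself to a strict one at [T] holds forever.
    At the infimum [a] of the times where [g] is negative, continuity gives [0 <= g a], hence
    [0 < g a], yet there are negative values arbitrarily close to the right of [a]. *)
Lemma continuous_induction (R : realType) (g : R -> R) :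
  (forall t, 0 <= t -> {for t, continuous g}) -> 0 <= g 0 ->
  (forall T, 0 <= T -> (forall t, 0 <= t <= T -> 0 <= g t) -> 0 < g T) ->
  forall t, 0 <= t -> 0 < g t.
Proof.
move=> cg g0 gP; suff gge0 t : 0 <= t -> 0 <= g t.
  by move=> t t0; apply: gP => // s /andP[s0 _]; exact: gge0.
move=> t0; rewrite leNgt; apply/negP => gt0.
pose S := [set s : R | 0 <= s /\ g s < 0].
have infS : has_inf S.
  by split; [exists t|exists 0 => s []].
pose a := inf S.
have a0 : 0 <= a by apply: lb_le_inf; [exists t|move=> s []].
have ga s : 0 <= s < a -> 0 <= g s.
  move=> /andP[s0 sa]; rewrite leNgt; apply/negP => gs.
  move: sa; rewrite ltNge => /negP; apply.
  by apply: ge_inf => //; exists 0 => r [].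
have gage0 : 0 <= g a.
  rewrite leNgt; apply/negP => ga0.
  have an0 : 0 < a.
    rewrite lt_neqAle a0 andbT; apply/eqP => a00.
    by move: ga0; rewrite -a00 ltNge g0.
  have /cvgrPdist_lt/(_ (- g a)) := cg a a0; rewrite oppr_gt0 => /(_ ga0).
  move=> /nbhs_ballP[d /= d0 dP].
  pose s := Num.max 0 (a - d / 2).
  have sa : s < a by rewrite gt_max an0/=; lra.
  have s0 : 0 <= s by rewrite le_max lexx.
  have : ball a d s.
    rewrite /ball/= ger0_norm ?subr_ge0 ?ltW//.
    have : a - d / 2 <= s by rewrite le_max lexx orbT.
    lra.
  move=> /dP; have := ga s; rewrite s0 sa => /(_ isT) gs.
  by rewrite ltr_norml => /andP[]; lra.
have ga_gt0 : 0 < g a.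
  apply: gP => // s /andP[s0]; rewrite le_eqVlt => /predU1P[->//|sa].
  by apply: ga; rewrite s0.
have /cvgrPdist_lt/(_ _ ga_gt0)/nbhs_ballP[d /= d0 dP] := cg a a0.
have [s [s0 gs] sad] := inf_adherent d0 infS.
have as_ : a <= s by apply: ge_inf => //; exists 0 => r [].
have /dP : ball a d s.
  by rewrite /ball/= distrC ger0_norm ?subr_ge0// ltrBlDl.
by rewrite ltr_norml => /andP[]; lra.
Qed.

(** The product of [u] with [expR (- K * t)] has nonpositive derivative. *)
Lemma gronwall (R : realType) (u du : R -> R) (K T : R) :
  (forall t : R, 0 <= t <= T -> is_derive t 1 u (du t)) ->
  (forall t, 0 <= t <= T -> du t <= K * u t) ->
  forall t, 0 <= t <= T -> u t <= u 0 * expR (K * t).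
Proof.
move=> hu duK t /andP[t0 tT].
pose v : R -> R := u * (expR \o ((- K) *: @id R)).
have hv (s : R) : 0 <= s <= T ->
    is_derive s 1 v ((du s - K * u s) * expR (- K * s)).
  move=> sT; have hus := hu s sT.
  have hl : is_derive s (1 : R) ((- K) *: @id R) (- K).
    by apply: is_derive_eq; rewrite /GRing.scale/= mulr1.
  have he : is_derive s (1 : R) (expR \o ((- K) *: @id R))
      (expR (- K * s) * - K).
    exact: is_derive1_comp.
  by apply: is_derive_eq; rewrite /GRing.scale/=; ring.
have cv : {within `[0, t], continuous v}.
  apply: derivable_within_continuous => s; rewrite in_itv/= => /andP[s0 st].
  by apply: (@ex_derive _ _ _ _ _ _ _ (hv s _)); rewrite s0 (le_trans st).
have : v t <= v 0.
  apply: (@ler0_derive1_le_cc _ v 0 t) => //.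
  - move=> s; rewrite in_itv/= => /andP[/ltW s0 /ltW st].
    by apply: (@ex_derive _ _ _ _ _ _ _ (hv s _)); rewrite s0 (le_trans st).
  - move=> s; rewrite in_itv/= => /andP[/ltW s0 /ltW st].
    have sT : 0 <= s <= T by rewrite s0 (le_trans st).
    rewrite derive1E (@derive_val _ _ _ _ _ _ _ (hv s sT)).
    by rewrite mulr_le0_ge0 ?expR_ge0// subr_le0 duK.
  - by rewrite in_itv/= lexx andbT.
  - by rewrite in_itv/= lexx.
have vE s : v s = u s * expR (- K * s) by [].
rewrite !vE mulr0 expR0 mulr1 mulNr expRN.
by rewrite ler_pdivrMr ?expR_gt0.
Qed.

(** * Gradients and semiconvexity *)

Definition sqnorm_mx (R : realType) m n (A : 'M[R]_(m, n)) : R :=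
  \sum_i \sum_j A i j ^+ 2.

Lemma sqnorm_mx_ge0 (R : realType) m n (A : 'M[R]_(m, n)) : 0 <= sqnorm_mx A.
Proof. by do 2![apply: sumr_ge0 => ? _]; exact: sqr_ge0. Qed.

Lemma euclid_norm_sqr (R : realType) m n (A : 'M[R]_(m, n)) :
  euclid_norm A ^+ 2 = sqnorm_mx A.
Proof. by rewrite sqr_sqrtr//; exact: sqnorm_mx_ge0. Qed.

Lemma sqnorm_mxZ (R : realType) m n (A : 'M[R]_(m, n)) (k : R) :
  sqnorm_mx (k *: A) = k ^+ 2 * sqnorm_mx A.
Proof.
rewrite /sqnorm_mx mulr_sumr; apply: eq_bigr => i _.
by rewrite mulr_sumr; apply: eq_bigr => j _; rewrite mxE exprMn.
Qed.

Lemma norm_mx_le_sqnorm (R : realType) m n (A : 'M[R]_(m, n)) :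
  `|A| <= 1 + sqnorm_mx A.
Proof.
have A0 := sqnorm_mx_ge0 A.
apply/normmx_le => [|i j]; first by lra.
apply: (@le_trans _ _ (1 + A i j ^+ 2)).
  (* For a real [a], the sum of [(1 - a) ^+ 2] and [a] is [1 + a ^+ 2 - a]. *)
  have : 0 <= (1 - `|A i j|) ^+ 2 + `|A i j| by rewrite addr_ge0 ?sqr_ge0.
  by rewrite -(real_normK (num_real (A i j))); nra.
rewrite lerD2l /sqnorm_mx (bigD1 i)//= (bigD1 j)//= -addrA lerDl addr_ge0//.
  by apply: sumr_ge0 => ? _; exact: sqr_ge0.
by do 2![apply: sumr_ge0 => ? _]; exact: sqr_ge0.
Qed.

Definition dotmx (R : realType) m n (A B : 'M[R]_(m, n)) : R :=
  \sum_i \sum_j A i j * B i j.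

Lemma dotmx_le (R : realType) m n (A B : 'M[R]_(m, n)) :
  2 * dotmx A B <= sqnorm_mx A + sqnorm_mx B.
Proof.
rewrite /dotmx /sqnorm_mx mulr_sumr -big_split/=; apply: ler_sum => i _.
rewrite mulr_sumr -big_split/=; apply: ler_sum => j _.
have := sqr_ge0 (A i j - B i j); nra.
Qed.

Lemma sqnorm_mxN (R : realType) m n (A : 'M[R]_(m, n)) :
  sqnorm_mx (- A) = sqnorm_mx A.
Proof. by rewrite -scaleN1r sqnorm_mxZ sqrrN expr1n mul1r. Qed.

Section gradient.
Context (R : realType) (N d : nat) (V : 'M[R]_(N, d) -> R^o).

Definition gradient (x : 'M[R]_(N, d)) : 'M[R]_(N, d) :=
  \matrix_(i, j) grad_var V i x 0 j.

Lemma diff_gradient (x A : 'M[R]_(N, d)) : differentiable V x ->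
  'd V x A = dotmx A (gradient x).
Proof.
move=> dV; rewrite [in LHS](matrix_sum_delta A) linear_sum/=.
apply: eq_bigr => i _; rewrite linear_sum/=; apply: eq_bigr => j _.
by rewrite linearZ/= !mxE deriveE.
Qed.

Lemma is_derive_comp_gradient (q : R -> 'M[R]_(N, d)) (t : R)
    (w : 'M[R]_(N, d)) :
  differentiable V (q t) -> is_derive t 1 q w ->
  is_derive t 1 (V \o q) (dotmx w (gradient (q t))).
Proof.
move=> dV dq; have dqt : differentiable q t.
  by apply/derivable1_diffP; exact: ex_derive.
apply: DeriveDef.
  by apply/derivable1_diffP; exact: differentiable_comp.
rewrite deriveE; last exact: differentiable_comp.
rewrite diff_comp//= diff_gradient//; congr dotmx.
by rewrite -deriveE// (@derive_val _ _ _ _ _ _ _ dq).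
Qed.

(** The convex function in [semiconvex] lies above its tangent at 0, whose slope is [gradient V 0]
    since the quadratic term is flat there; Young's inequality absorbs the linear term. *)
Lemma semiconvex_quadratic_bound : differentiable V 0 -> semiconvex V ->
  exists a b : R, [/\ 0 <= a, 0 <= b & forall x, - a - b * sqnorm_mx x <= V x].
Proof.
move=> dV [C C0 cvx].
(* Convexity between 0 and [x]; the quadratic term at [t *: x] is nonnegative and is dropped. *)
have convex_chord (x : 'M[R]_(N, d)) (t : R) : 0 < t < 1 ->
    V (t *: x) - V 0 <= t * (V x + C / 2 * sqnorm_mx x - V 0).
  move=> /andP[t0 t1].
  have := cvx (Itv01 (ltW t0) (ltW t1)) x 0; rewrite !inE => /(_ I I).
  rewrite convRE (_ : conv _ (x : convex_lmodType _) _ =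
      (t *: x : convex_lmodType 'M_(N, d))); last first.
    by rewrite /conv/= scaler0 addr0.
  have sq0 : sqnorm_mx (0 : 'M[R]_(N, d)) = 0.
    by rewrite -(scale0r 0) sqnorm_mxZ expr0n mul0r.
  rewrite !euclid_norm_sqr sqnorm_mxZ sq0 mulr0 addr0 /= /unstable.onem.
  have : 0 <= C / 2 * t ^+ 2 by rewrite mulr_ge0 ?sqr_ge0//; lra.
  move=> /mulr_ge0/(_ (sqnorm_mx_ge0 x)); lra.
(* Divided by [t], the chord bound caps the difference quotients of [V] at 0 in direction [x], whose
   limit is this dot product. *)
have slope x : dotmx x (gradient 0) <= V x + C / 2 * sqnorm_mx x - V 0.
  rewrite leNgt; apply/negP; set r := (X in X < _) => rD.
  have rD0 : 0 < dotmx x (gradient 0) - r by rewrite subr_gt0.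
  have /cvgrPdist_lt := diff_derivable (v := x) dV.
  rewrite -/(derive V 0 x) deriveE// diff_gradient// => /(_ _ rD0).
  move=> /nbhs_ballP[e /= e0 eP].
  pose t := Num.min (1 / 2) (e / 2).
  have t0 : 0 < t by rewrite lt_min; apply/andP; split; lra.
  have te : t <= e / 2 by rewrite ge_min lexx orbT.
  have t1 : t <= 1 / 2 by rewrite ge_min lexx.
  have := eP t; rewrite /ball/= sub0r normrN gtr0_norm//.
  move=> /(_ ltac:(lra) (lt0r_neq0 t0)).
  have /(convex_chord x) : 0 < t < 1 by rewrite t0; lra.
  rewrite addr0 -/r mulrC -ler_pdivrMr// mulrC => tr.
  rewrite ltr_norml => /andP[_]; rewrite /GRing.scale/=; lra.
pose Gam := sqnorm_mx (gradient 0).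
have Gam0 : 0 <= Gam := sqnorm_mx_ge0 _.
exists (`|V 0| + Gam / 2), (C / 2 + 1 / 2); split.
- by rewrite addr_ge0// divr_ge0.
- lra.
move=> x; have := slope x; have := dotmx_le (- x) (gradient 0).
have -> : dotmx (- x) (gradient 0) = - dotmx x (gradient 0).
  rewrite /dotmx -sumrN; apply: eq_bigr => i _; rewrite -sumrN.
  by apply: eq_bigr => j _; rewrite mxE mulNr.
rewrite sqnorm_mxN -/Gam; have := ler_norm (- V 0); rewrite normrN; lra.
Qed.

End gradient.

(** * Energy and growth of solutions *)

Lemma is_derive_sum2 (R : realType) m n (f : 'I_m -> 'I_n -> R -> R)
    (df : 'I_m -> 'I_n -> R) (t : R) :
  (forall i j, is_derive t 1 (f i j) (df i j)) ->
  is_derive t 1 (fun s => \sum_i \sum_j f i j s) (\sum_i \sum_j df i j).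
Proof.
move=> hf; have -> : (fun s => \sum_i \sum_j f i j s) = \sum_i \sum_j f i j.
  apply/funext => s; rewrite fct_sumE; apply: eq_bigr => i _.
  by rewrite fct_sumE.
by apply: is_derive_sum => i; apply: is_derive_sum => j.
Qed.

Lemma is_derive_mx_entry (R : realType) m n (A : R -> 'M[R]_(m, n)) (t : R)
    (dA : 'M[R]_(m, n)) i j :
  is_derive t 1 A dA -> is_derive t 1 (fun s => A s i j) (dA i j).
Proof.
move=> hA; have dAt : derivable A t 1 by exact: ex_derive.
apply: DeriveDef; first exact: (iffLR (derivable_mxP A t 1) dAt).
have := derive_mx dAt; rewrite (@derive_val _ _ _ _ _ _ _ hA) => ->.
by rewrite mxE.
Qed.

(** The row weights let one formula serve both the kinetic energy and the squared norm of the
    positions. *)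
Lemma is_derive_sqnorm (R : realType) m n (A : R -> 'M[R]_(m, n)) (t : R)
    (dA : 'M[R]_(m, n)) (c : 'I_m -> R) :
  is_derive t 1 A dA ->
  is_derive t 1 (fun s => \sum_i \sum_j c i * A s i j ^+ 2)
    (\sum_i \sum_j 2 * c i * A t i j * dA i j).
Proof.
move=> hA; apply: is_derive_sum2 => i j.
have hij := is_derive_mx_entry i j hA.
have -> : (fun s => c i * A s i j ^+ 2) =
    c i *: ((fun s => A s i j) * (fun s => A s i j)).
  by apply/funext => s; rewrite expr2.
by apply: is_derive_eq; rewrite /GRing.scale/=; ring.
Qed.

Section newton.
Context (R : realType) (N d : nat) (V : 'M[R]_(N, d) -> R^o) (m : 'I_N -> R).
Hypothesis dV : forall x, differentiable V x.
Hypothesis m_gt0 : forall i, 0 < m i.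

Definition acceleration (q : 'M[R]_(N, d)) : 'M[R]_(N, d) :=
  \matrix_(i, j) (- ((m i)^-1 * gradient V q i j)).

Definition kinetic (w : 'M[R]_(N, d)) : R :=
  \sum_i \sum_j m i / 2 * w i j ^+ 2.

(** Entry by entry, the derivative of the kinetic energy cancels that of [V] along [q]. The
    equations are assumed only up to [T] because the clamped system is known to agree with Newton's
    only as long as the radius is respected. *)
Lemma energy_conservation (q w : R -> 'M[R]_(N, d)) (T : R) :
  (forall t : R, 0 <= t <= T -> is_derive t 1 q (w t)) ->
  (forall t : R, 0 <= t <= T -> is_derive t 1 w (acceleration (q t))) ->
  forall t, 0 <= t <= T -> kinetic (w t) + V (q t) = kinetic (w 0) + V (q 0).
Proof.
move=> hq hw t /andP[t0 tT].
pose E : R -> R := (fun s => kinetic (w s)) + (V \o q).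
have hE s : 0 <= s <= T -> is_derive s 1 E 0.
  move=> sT; have hqs := hq s sT.
  have hK := is_derive_sqnorm (fun i => m i / 2) (hw s sT).
  have hU := is_derive_comp_gradient (dV (q s)) hqs.
  apply: (is_derive_eq (is_deriveD hK hU)).
  rewrite /dotmx -big_split/= big1// => i _; rewrite -big_split/= big1// => j _.
  by rewrite !mxE; have := lt0r_neq0 (m_gt0 i) => mi; field.
have [||c _] := @MVT_segment _ E (fun=> 0) 0 t t0.
- move=> s; rewrite in_itv/= => /andP[/ltW s0 /ltW st]; apply: hE.
  by rewrite s0 (le_trans st).
- apply: derivable_within_continuous => s; rewrite in_itv/= => /andP[s0 st].
  by apply: (@ex_derive _ _ _ _ _ _ _ (hE s _)); rewrite s0 (le_trans st).
by rewrite mul0r => /eqP; rewrite subr_eq0 => /eqP.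
Qed.

(** The sum of the inverse masses stands in for the largest one and makes sense for [N = 0] too. *)
Lemma sqnorm_le_kinetic (w : 'M[R]_(N, d)) :
  sqnorm_mx w <= 2 * (\sum_i (m i)^-1) * kinetic w.
Proof.
rewrite /kinetic mulr_sumr; apply: ler_sum => i _.
rewrite mulr_sumr; apply: ler_sum => j _.
have mi := m_gt0 i.
have : (m i)^-1 <= \sum_i (m i)^-1.
  rewrite (bigD1 i)//= lerDl; apply: sumr_ge0 => k _.
  by rewrite invr_ge0 ltW.
have -> : 2 * (\sum_i (m i)^-1) * (m i / 2 * w i j ^+ 2) =
    (\sum_i (m i)^-1) * m i * w i j ^+ 2 by field.
rewrite -[(m i)^-1]mul1r ler_pdivrMr// => ?.
by rewrite ler_peMl ?sqr_ge0.
Qed.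

(** [D] and [K] are chosen before the solution and [T], so they can define the clamping radius.
    Gronwall applies to [1 + sqnorm_mx (q t)], whose derivative is at most the sum of the squared
    norms of [q t] and [w t]. *)
Lemma newton_growth (a b : R) (q0 w0 : 'M[R]_(N, d)) : 0 <= a -> 0 <= b ->
  (forall x, - a - b * sqnorm_mx x <= V x) ->
  exists D K : R, [/\ 0 <= D, 0 <= K & forall (q w : R -> 'M[R]_(N, d)) (T : R),
    0 <= T -> q 0 = q0 -> w 0 = w0 ->
    (forall t : R, 0 <= t <= T -> is_derive t 1 q (w t)) ->
    (forall t : R, 0 <= t <= T -> is_derive t 1 w (acceleration (q t))) ->
    `|q T| <= D * expR (K * T) /\ `|w T| <= D * expR (K * T)].
Proof.
move=> a0 b0 Vab.
(* The kinetic energy is the initial energy minus [V], hence at most this last factor times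
   [1 + sqnorm_mx (q t)]. *)
pose c := 2 * (\sum_i (m i)^-1) * (`|kinetic w0 + V q0| + a + b).
have s0 : 0 <= 2 * (\sum_i (m i)^-1).
  by rewrite mulr_ge0// sumr_ge0// => i _; rewrite invr_ge0 ltW.
have c0 : 0 <= c by rewrite mulr_ge0// !addr_ge0.
(* The factor [1 + c] in [D] is for the velocity: its norm is at most [1 + c * u T], and
   [1 <= u T]. *)
exists ((1 + c) * (1 + sqnorm_mx q0)), (1 + c); split.
- by rewrite mulr_ge0// addr_ge0// sqnorm_mx_ge0.
- by rewrite addr_ge0.
move=> q w T T0 q0E w0E hq hw.
have wq t : 0 <= t <= T -> sqnorm_mx (w t) <= c * (1 + sqnorm_mx (q t)).
  move=> tT; apply: le_trans (sqnorm_le_kinetic _) _.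
  rewrite /c -[leRHS]mulrA ler_wpM2l//.
  have := energy_conservation hq hw tT; rewrite q0E w0E.
  have := Vab (q t); have := ler_norm (kinetic w0 + V q0).
  have := sqnorm_mx_ge0 (q t); have := normr_ge0 (kinetic w0 + V q0); nra.
pose u t := 1 + sqnorm_mx (q t).
have hu (t : R) : 0 <= t <= T -> is_derive t 1 u (2 * dotmx (q t) (w t)).
  move=> tT; have hs := is_derive_sqnorm (fun=> 1) (hq t tT).
  have -> : u = cst 1 + (fun s => \sum_i \sum_j 1 * q s i j ^+ 2).
    apply/funext => s; rewrite /u /sqnorm_mx; congr (_ + _).
    by apply: eq_bigr => i _; apply: eq_bigr => j _; rewrite mul1r.
  apply: is_derive_eq; rewrite add0r /dotmx mulr_sumr.
  apply: eq_bigr => i _; rewrite mulr_sumr; apply: eq_bigr => j _; ring.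
have uK t : 0 <= t <= T -> 2 * dotmx (q t) (w t) <= (1 + c) * u t.
  move=> tT; apply: le_trans (dotmx_le _ _) _; have := wq t tT.
  rewrite /u; nra.
have TT : 0 <= T <= T by rewrite T0 lexx.
have := gronwall hu uK TT; rewrite {2}/u q0E -mulrA.
set e := (_ * expR _) => uT.
have u1 : 1 <= u T by rewrite /u lerDl sqnorm_mx_ge0.
have cu : (1 + c) * u T <= (1 + c) * e by rewrite ler_wpM2l// addr_ge0.
have := wq T TT; rewrite -/(u T) => wT.
split; [have := norm_mx_le_sqnorm (q T); rewrite -/(u T)|
        have := norm_mx_le_sqnorm (w T)]; nra.
Qed.

End newton.

(** * Global solutions *)

Lemma is_derive_fst (R : realType) (U W : normedModType R) (z : R -> U * W)
    (t : R) (p : U * W) :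
  is_derive t 1 z p -> is_derive t 1 (fst \o z) p.1.
Proof.
move=> [dz <-]; set D := 'D_1 z t.
have cv : h^-1 *: ((fst \o z \o shift t) (h *: 1) - (fst \o z) t)
    @[h --> 0^'] --> D.1.
  have cz : h^-1 *: ((z \o shift t) (h *: 1) - z t) @[h --> 0^'] --> D by [].
  have := @cvg_comp _ _ _ _ (@fst U W) _ _ _ cz; apply; case: D {cz} => D1 D2.
  exact: cvg_fst.
by apply: DeriveDef; [apply/cvg_ex; exists D.1|exact: cvg_lim].
Qed.

Lemma is_derive_snd (R : realType) (U W : normedModType R) (z : R -> U * W)
    (t : R) (p : U * W) :
  is_derive t 1 z p -> is_derive t 1 (snd \o z) p.2.
Proof.
move=> [dz <-]; set D := 'D_1 z t.
have cv : h^-1 *: ((snd \o z \o shift t) (h *: 1) - (snd \o z) t)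
    @[h --> 0^'] --> D.2.
  have cz : h^-1 *: ((z \o shift t) (h *: 1) - z t) @[h --> 0^'] --> D by [].
  have := @cvg_comp _ _ _ _ (@snd U W) _ _ _ cz; apply; case: D {cz} => D1 D2.
  exact: cvg_snd.
by apply: DeriveDef; [apply/cvg_ex; exists D.2|exact: cvg_lim].
Qed.

Lemma is_derive_row (R : realType) m n (A : R -> 'M[R]_(m, n)) (t : R)
    (dA : 'M[R]_(m, n)) i :
  is_derive t 1 A dA -> is_derive t 1 (fun s => row i (A s)) (row i dA).
Proof.
move=> hA.
have hij j : is_derive t 1 (fun s => row i (A s) 0 j) (dA i j).
  under eq_fun do rewrite mxE; exact: is_derive_mx_entry.
have dr : derivable (fun s => row i (A s)) t 1.
  by apply/derivable_mxP => k j; rewrite (ord1 k); exact: ex_derive.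
apply: DeriveDef => //; rewrite derive_mx//.
by apply/rowP => j; rewrite !mxE (@derive_val _ _ _ _ _ _ _ (hij j)).
Qed.

Section newton_solution.
Context (R : realType) (N d : nat) (V : 'M[R]_(N, d) -> R^o) (m : 'I_N -> R).
Hypothesis hV : continuously_differentiable V.
Hypothesis m_gt0 : forall i, 0 < m i.

Lemma continuous_acceleration : continuous (acceleration V m).
Proof.
move=> q; apply: (@cvg_mx _ _ (nbhs q)) => i j.
have aE x : acceleration V m x i j = - ((m i)^-1 * grad_var V i x 0 j).
  by rewrite mxE [gradient _ _ _ _]mxE.
under eq_fun do rewrite aE; rewrite aE.
have cgrad := @continuous_comp _ _ _ (grad_var V i)
  (fun B : 'rV[R]_d => B 0 j) q.
apply: cvgN; apply: cvgM; first exact: cvg_cst.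
by apply: cgrad; [exact: (hV.2 i)|exact: coord_continuous].
Qed.

Lemma newton_solution (q0 w0 : 'M[R]_(N, d)) : semiconvex V ->
  exists q w : R -> 'M[R]_(N, d), [/\ q 0 = q0, w 0 = w0,
    forall t : R, 0 <= t -> is_derive t 1 q (w t) &
    forall t : R, 0 <= t -> is_derive t 1 w (acceleration V m (q t))].
Proof.
move=> sV; have [dV _] := hV.
have [a [b [a0 b0 Vab]]] := semiconvex_quadratic_bound (dV 0) sV.
have [D [K [D0 K0 DK]]] := newton_growth dV m_gt0 q0 w0 a0 b0 Vab.
(* The added constant makes [M] strictly larger than the growth bound and at least the norm of the
   initial datum. *)
pose M t : R := D * expR (K * t) + (1 + `|(q0, w0)|).
have M0 t : 0 <= M t by rewrite addr_ge0// mulr_ge0// expR_ge0.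
have cM : continuous M.
  move=> t; apply: cvgD; last exact: cvg_cst.
  apply: cvgM; first exact: cvg_cst.
  apply: continuous_comp; last exact: continuous_expR.
  exact: mulrl_continuous.
pose X := ('M[R]_(N, d) * 'M[R]_(N, d))%type.
pose G t (z : X) : X :=
  (clamp_mx (M t) z.2, acceleration V m (clamp_mx (M t) z.1)).
have cG : continuous (fun p : R * X => G p.1 p.2).
  move=> p.
  have cMp : {for p, continuous (fun p : R * X => M p.1)}.
    by apply: continuous_comp; [exact: cvg_fst|exact: cM].
  have cp1 : {for p, continuous (fun p : R * X => p.2.1)}.
    by apply: continuous_comp; [exact: cvg_snd|exact: cvg_fst].
  have cp2 : {for p, continuous (fun p : R * X => p.2.2)}.
    by apply: continuous_comp; [exact: cvg_snd|exact: cvg_snd].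
  have c2 := continuous_clamp_mx cMp cp2.
  have c1 : {for p, continuous (fun p : R * X =>
      acceleration V m (clamp_mx (M p.1) p.2.1))}.
    apply: (@continuous_comp _ _ _ (fun p : R * X => clamp_mx (M p.1) p.2.1)).
      exact: continuous_clamp_mx.
    exact: continuous_acceleration.
  exact: (cvg_pair c2 c1).
(* [M] is nondecreasing, so up to time [T] all clamped arguments lie in the compact ball of radius
   [M T]. *)
have bG T : exists B : R, forall (t : R) z, 0 <= t <= T -> `|G t z| <= B.
  have : bounded_set (acceleration V m @` [set A | `|A| <= M T]).
    apply: compact_bounded; apply: continuous_compact.
      by apply: continuous_subspaceT => ?; exact: continuous_acceleration.
    exact: compact_ball_mx.
  move=> /ex_strict_bound_gt0[B B0 /= bB].
  exists (Num.max (M T) B) => t z /andP[t0 tT].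
  have MtT : M t <= M T.
    by rewrite lerD2r ler_wpM2l// ler_expR ler_wpM2l.
  rewrite prod_normE/= ge_max !le_max (le_trans (norm_clamp_mx _ (M0 t)) MtT)/=.
  apply/orP; right; apply/ltW/bB; exists (clamp_mx (M t) z.1) => //=.
  exact: le_trans (norm_clamp_mx _ (M0 t)) MtT.
have cX := compact_ball_pair (@compact_ball_mx R N d) (@compact_ball_mx R N d).
have [z z0 hz] := peano (q0, w0) cG cX bG.
pose q := fst \o z; pose w := snd \o z.
have hq t : 0 <= t -> `|z t| <= M t -> is_derive t 1 q (w t).
  move=> t0; rewrite prod_normE ge_max => /andP[zM1 zM2].
  by have /is_derive_fst := hz t t0; rewrite /= clamp_mx_id.
have hw t : 0 <= t -> `|z t| <= M t -> is_derive t 1 w (acceleration V m (q t)).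
  move=> t0; rewrite prod_normE ge_max => /andP[zM1 zM2].
  by have /is_derive_snd := hz t t0; rewrite /= clamp_mx_id.
(* While the norm of [z] is at most [M], clamping is invisible and [z] solves Newton's system;
   [newton_growth] then improves the bound to a strict one. *)
have zM t : 0 <= t -> 0 < M t - `|z t|.
  apply: (@continuous_induction _ (fun t => M t - `|z t|)) =>
      {t} [t t0||T T0 MT].
  - apply: cvgB; first exact: cM.
    apply: cvg_norm; apply: differentiable_continuous.
    by apply/derivable1_diffP; exact: (@ex_derive _ _ _ _ _ _ _ (hz t t0)).
  - rewrite z0 subr_ge0 -lerBlDr opprD addrCA subrr addr0.
    rewrite (@le_trans _ _ 0)// ?lerN10// mulr_ge0// expR_ge0.
  have MT' t : 0 <= t <= T -> `|z t| <= M t by move/MT; rewrite subr_ge0.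
  have [] := DK q w T T0.
  - by rewrite /q/= z0.
  - by rewrite /w/= z0.
  - by move=> t tT; apply: hq; [case/andP: tT|exact: MT'].
  - by move=> t tT; apply: hw; [case/andP: tT|exact: MT'].
  move=> qT wT; rewrite subr_gt0 prod_normE gt_max.
  have KT : D * expR (K * T) < M T by rewrite ltrDl ltr_pwDl.
  by apply/andP; split; [exact: le_lt_trans qT KT|exact: le_lt_trans wT KT].
exists q, w; split; rewrite /q /w /= ?z0//.
- by move=> t t0; apply: hq => //; rewrite ltW// -subr_gt0 zM.
- by move=> t t0; apply: hw => //; rewrite ltW// -subr_gt0 zM.
Qed.

End newton_solution.

(** * One-sided derivatives on the half-line *)

Lemma within_ray_proper (R : realType) (t : R) : 0 <= t ->
  ProperFilter (within `[0, +oo[ t^').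
Proof.
move=> t0; apply: Build_ProperFilter_ex => P [e /= e0 eP].
exists (t + e / 2); apply: eP => /=.
- by rewrite /ball/= opprD addrA subrr sub0r normrN gtr0_norm; lra.
- by rewrite -subr_eq0 addrAC subrr add0r; apply/eqP; lra.
- by rewrite in_itv/= andbT; lra.
Qed.

Lemma is_derive_cvg_within (R : realType) (W : normedModType R) (A : set R)
    (f g : R -> W) (t : R) (a : W) : A t -> (forall s, A s -> f s = g s) ->
  is_derive t 1 g a ->
  (s - t)^-1 *: (f s - f t) @[s --> within A t^'] --> a.
Proof.
move=> At fg [dg <-]; apply/cvgrPdist_lt => e e0.
have /cvgrPdist_lt/(_ e e0)/nbhs_ballP[d /= d0 dP] := dg.
exists d => //= s ts st As; rewrite (fg _ As) (fg _ At).
have := dP (s - t); rewrite /= [(s - t) *: 1]mulr1 subrK; apply.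
  by rewrite /ball/= sub0r normrN distrC.
by rewrite subr_eq0.
Qed.

(** Asking for agreement of [f] and [g] only on the ray allows a second use with [f] itself a
    [derive_within], whose values at negative times are uncontrolled. *)
Lemma C1_within_ray (R : realType) (W : normedModType R) (f g df : R -> W) :
  (forall t, 0 <= t -> f t = g t) ->
  (forall t : R, 0 <= t -> is_derive t 1 g (df t)) ->
  (forall t, 0 <= t -> {for t, continuous df}) ->
  C1_within `[0, +oo[ f /\
    forall t, 0 <= t -> derive_within `[0, +oo[ f t = df t.
Proof.
move=> fg hg cdf.
have ray (t : R) : `[0, +oo[%classic t -> 0 <= t by rewrite /= in_itv/= andbT.
have cv (t : R) : 0 <= t ->
    (s - t)^-1 *: (f s - f t) @[s --> within `[0, +oo[ t^'] --> df t.
  move=> t0; apply: is_derive_cvg_within (hg t t0) => [|s /ray]; last exact: fg.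
  by rewrite /= in_itv/= t0.
have dE (t : R) : 0 <= t -> derive_within `[0, +oo[ f t = df t.
  (* Properness of the punctured filter is what makes the limit unique, in particular at the
     endpoint 0. *)
  move=> t0; have := within_ray_proper t0 => ?.
  by apply: cvg_lim => //; exact: cv.
split=> //; split=> [t /ray t0|].
  by apply/cvg_ex; exists (df t); exact: cv.
apply: (@subspace_eq_continuous _ _ _ df).
  by move=> t; rewrite inE => /ray t0; exact/esym/dE.
by apply: continuous_in_subspaceT => t; rewrite inE => /ray; exact: cdf.
Qed.

Lemma continuous_row (R : realType) m n i : continuous (@row R m n i).
Proof.
move=> A; apply: (@cvg_mx _ _ (nbhs A)) => k j.
under eq_fun do rewrite mxE; rewrite mxE; exact: coord_continuous.
Qed.

Unset Implicit Arguments.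

Theorem proposition2p1 (R : realType) (d N : nat) (V : 'M[R]_(N, d) -> R^o)
    (hV : continuously_differentiable V) (hVsc : semiconvex V)
    (m : 'I_N -> R) (hm : forall i, 0 < m i)
    (x v : 'I_N -> 'rV[R]_d) :
  exists gamma : 'I_N -> R -> 'rV[R]_d,
    (forall i, C2_within `[0, +oo[ (gamma i)) /\
    (forall i t, 0 < t ->
       m i *: derive_within `[0, +oo[ (derive_within `[0, +oo[ (gamma i)) t
       = - grad_var V i (\matrix_(k < N) gamma k t)) /\
    (forall i, gamma i 0 = x i) /\
    (forall i, derive_within `[0, +oo[ (gamma i) 0 = v i).
Proof.
have [q [w [q0 w0 hq hw]]] :=
  newton_solution hV hm (\matrix_(i < N) x i) (\matrix_(i < N) v i) hVsc.
have cq (t : R) : 0 <= t -> {for t, continuous q}.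
  move=> t0; apply: differentiable_continuous; apply/derivable1_diffP.
  exact: (@ex_derive _ _ _ _ _ _ _ (hq t t0)).
have cw (t : R) : 0 <= t -> {for t, continuous w}.
  move=> t0; apply: differentiable_continuous; apply/derivable1_diffP.
  exact: (@ex_derive _ _ _ _ _ _ _ (hw t t0)).
have C1q i := C1_within_ray (fun t _ => erefl (row i (q t)))
  (fun t t0 => is_derive_row i (hq t t0))
  (fun t t0 => continuous_comp (cw t t0) (@continuous_row R N d i _)).
(* Second use: on the ray the derivative of [row i (q t)] is [row i (w t)], by the second part of
   [C1q]. *)
have C1w i := C1_within_ray (fun t t0 => (C1q i).2 t t0)
  (fun t t0 => is_derive_row i (hw t t0))
  (fun t t0 => continuous_comp
    (continuous_comp (cq t t0) (@continuous_acceleration _ _ _ _ m hV _))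
    (@continuous_row R N d i _)).
exists (fun i t => row i (q t)); split; [|split; [|split]].
- by move=> i; split; [exact: (C1q i).1|exact: (C1w i).1].
- move=> i t t0; rewrite (C1w i).2 ?ltW//.
  have -> : \matrix_(k < N) row k (q t) = q t.
    by apply/matrixP => k j; rewrite !mxE.
  apply/rowP => j; rewrite !mxE mulrN mulrA mulfV ?mul1r//.
  exact: lt0r_neq0.
- by move=> i; rewrite q0 rowK.
- by move=> i; rewrite (C1q i).2// w0 rowK.
Qed.
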